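(* Let $\mathbb{C}$ be a finitely complete $\mathsf{Ord}$-enriched category which admits comma objects. The following statements are equivalent: (i) The horizontal comma object functor $H_{\alpha}\colon \mathsf{Pt}_Y(\mathbb{C})\to \mathsf{Pt}_A(\mathbb{C})$ is conservative for every morphism $\alpha\colon A\to Y$ of $\mathbb{C}$. (ii) For every morphism $\alpha\colon A\to Y$ and every point $(f\colon X\to Y,\ s\colon Y\to X)$ over $Y$ (so $fs=1_Y$), with $(f/\alpha,\pi_1\colon f/\alpha\to X,\pi_2\colon f/\alpha\to A)$ the comma object of $(f,\alpha)$ (regarded as a point over $A$ via $\pi_2$ and its section $i_2=\langle s\alpha,1_A\rangle$), the pair $(\pi_1\colon f/\alpha\to X,\ s\colon Y\to X)$ is jointly extremally epimorphic.
   Context: $\mathsf{Ord}$ is the category of preordered sets (reflexive, transitive relations) and monotone maps. An $\mathsf{Ord}$-enriched category $\mathbb{C}$ is a category whose hom-sets $\mathbb{C}(X,Y)$ carry a preorder $\preccurlyeq$ preserved by pre- and postcomposition. ''Finitely complete'' means that it has finite limits. Comma object of an ordered pair $(f\colon X\to Y,\ g\colon Z\to Y)$: an object $f/g$ with morphisms $\pi_1\colon f/g\to X$, $\pi_2\colon f/g\to Z$ such that (C1) $f\pi_1\preccurlyeq g\pi_2$; (C2) for all $a\colon A\to X$, $b\colon A\to Z$ with $fa\preccurlyeq gb$ there is a unique $\lambda=\langle a,b\rangle\colon A\to f/g$ with $\pi_1\lambda=a$, $\pi_2\lambda=b$; (C3) if $fa\preccurlyeq gb$, $fa'\preccurlyeq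 gb'$, $a\preccurlyeq a'$ and $b\preccurlyeq b'$, then $\langle a,b\rangle\preccurlyeq\langle a',b'\rangle$. ''$\mathbb{C}$ admits comma objects'' means that every such pair has one. A point over $Y$ is a pair $(f\colon X\to Y,\ s\colon Y\to X)$ with $fs=1_Y$. $\mathsf{Pt}_Y(\mathbb{C})$ is the category of points over $Y$; a morphism $\gamma\colon(g\colon Z\to Y,t)\to(f\colon X\to Y,s)$ is a morphism $\gamma\colon Z\to X$ with $f\gamma=g$ and $\gamma t=s$. For $\alpha\colon A\to Y$, the horizontal comma object change-of-base functor $H_\alpha\colon\mathsf{Pt}_Y(\mathbb{C})\to\mathsf{Pt}_A(\mathbb{C})$ sends $(f,s)$ to the point $(\pi_2\colon f/\alpha\to A,\ \langle s\alpha,1_A\rangle\colon A\to f/\alpha)$, where $(f/\alpha,\pi_1,\pi_2)$ is the comma object of $(f,\alpha)$, and sends $\gamma\colon(g,t)\to(f,s)$ to the morphism $g/\alpha\to f/\alpha$ induced by the universal property, namely $\langle\gamma\rho_1,\rho_2\rangle$ with $\rho_1,\rho_2$ the projections of $g/\alpha$. A functor is conservative if it reflects isomorphisms. A pair of morphisms with common codomain $X$ is jointly extremally epimorphic if every monomorphism $m\colon M\to X$ through which both of them factor is an isomorphism. *)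

(* Defs.v *)
From Stdlib Require Import RelationClasses Relation_Definitions List FinFun ProofIrrelevance.

Set Implicit Arguments.
Unset Strict Implicit.
Unset Printing Implicit Defensive.

Declare Scope cat_scope.
Delimit Scope cat_scope with cat.
Open Scope cat_scope.

Reserved Notation "g ∘ f" (at level 40, left associativity).
Reserved Notation "f ≼ g" (at level 70, no associativity).

Record Category := {
  Obj :> Type;
  Hom : Obj -> Obj -> Type;
  idm : forall X, Hom X X;
  comp : forall X Y Z, Hom Y Z -> Hom X Y -> Hom X Z;
  comp_idl : forall X Y (f : Hom X Y), comp (idm Y) f = f;
  comp_idr : forall X Y (f : Hom X Y), comp f (idm X) = f;
  comp_assoc : forall W X Y Z (h : Hom Y Z) (g : Hom X Y) (f : Hom W X),
    comp h (comp g f) = comp (comp h g) f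
}.

Arguments Hom {c} X Y.
Arguments idm {c} X.
Arguments comp {c X Y Z} g f.
Notation "g ∘ f" := (comp g f) : cat_scope.

Definition is_iso (C : Category) (X Y : C) (f : Hom X Y) : Prop :=
  exists g : Hom Y X, g ∘ f = idm X /\ f ∘ g = idm Y.

Definition is_mono (C : Category) (X Y : C) (f : Hom X Y) : Prop :=
  forall (W : C) (u v : Hom W X), f ∘ u = f ∘ v -> u = v.

Definition jointly_extremally_epic (C : Category) (A B X : C)
    (a : Hom A X) (b : Hom B X) : Prop :=
  forall (M : C) (m : Hom M X), is_mono m ->
    (exists a' : Hom A M, m ∘ a' = a) ->
    (exists b' : Hom B M, m ∘ b' = b) ->
    is_iso m.

Record Functor (C D : Category) := {
  fobj :> C -> D;
  fmap : forall X Y : C, Hom X Y -> Hom (fobj X) (fobj Y);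
  fmap_id : forall X : C, fmap (idm X) = idm (fobj X);
  fmap_comp : forall (X Y Z : C) (g : Hom Y Z) (f : Hom X Y),
    fmap (g ∘ f) = fmap g ∘ fmap f
}.

Arguments fmap {C D} F {X Y} f : rename.

Definition conservative (C D : Category) (F : Functor C D) : Prop :=
  forall (X Y : C) (f : Hom X Y), is_iso (fmap F f) -> is_iso f.

Definition finite_category (J : Category) : Prop :=
  Finite J /\ forall i j : J, Finite (Hom i j).

Record Cone (J C : Category) (D : Functor J C) := {
  vertex : C;
  leg : forall j : J, Hom vertex (D j);
  leg_natural : forall (i j : J) (u : Hom i j), fmap D u ∘ leg i = leg j
}.

Definition is_limit (J C : Category) (D : Functor J C) (L : Cone D) : Prop :=
  forall K : Cone D,
    exists! h : Hom (vertex K) (vertex L), forall j : J, leg L j ∘ h = leg K j.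

Definition finitely_complete (C : Category) : Prop :=
  forall J : Category, finite_category J ->
  forall D : Functor J C, exists L : Cone D, is_limit L.

Record OrdCategory := {
  ocat :> Category;
  hle : forall X Y : ocat, relation (Hom X Y);
  hle_preorder : forall X Y : ocat, PreOrder (@hle X Y);
  hle_postcomp : forall (X Y Z : ocat) (h : Hom Y Z) (f g : Hom X Y),
    hle f g -> hle (h ∘ f) (h ∘ g);
  hle_precomp : forall (W X Y : ocat) (f g : Hom X Y) (h : Hom W X),
    hle f g -> hle (f ∘ h) (g ∘ h)
}.

Arguments hle {o X Y} f g.
Notation "f ≼ g" := (hle f g) : cat_scope.

(** The mediating morphism [pairing] formally takes a proof [H] of
    [f ∘ a ≼ g ∘ b]; by [pairing_unique] it does not depend on [H]. *)
Record CommaObject (C : OrdCategory) (X Y Z : C) (f : Hom X Y) (g : Hom Z Y) := {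
  capex : C;
  cpi1 : Hom capex X;
  cpi2 : Hom capex Z;
  comma_le : f ∘ cpi1 ≼ g ∘ cpi2;
  pairing : forall (A : C) (a : Hom A X) (b : Hom A Z),
    f ∘ a ≼ g ∘ b -> Hom A capex;
  pairing_pi1 : forall (A : C) (a : Hom A X) (b : Hom A Z) (H : f ∘ a ≼ g ∘ b),
    cpi1 ∘ pairing H = a;
  pairing_pi2 : forall (A : C) (a : Hom A X) (b : Hom A Z) (H : f ∘ a ≼ g ∘ b),
    cpi2 ∘ pairing H = b;
  pairing_unique : forall (A : C) (a : Hom A X) (b : Hom A Z)
      (H : f ∘ a ≼ g ∘ b) (l : Hom A capex),
    cpi1 ∘ l = a -> cpi2 ∘ l = b -> l = pairing H;
  pairing_le : forall (A : C) (a a' : Hom A X) (b b' : Hom A Z)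
      (H : f ∘ a ≼ g ∘ b) (H' : f ∘ a' ≼ g ∘ b'),
    a ≼ a' -> b ≼ b' -> pairing H ≼ pairing H'
}.

(** A choice of comma objects, which is what the functor [Hcomma] below is
    built from. *)
Definition comma_objects (C : OrdCategory) : Type :=
  forall (X Y Z : C) (f : Hom X Y) (g : Hom Z Y), CommaObject f g.

Section Points.

Variables (C : Category) (Y : C).

Record Point := {
  pt_dom : C;
  pt_map : Hom pt_dom Y;
  pt_sec : Hom Y pt_dom;
  pt_split : pt_map ∘ pt_sec = idm Y
}.

Record PointHom (P Q : Point) := {
  pt_hom :> Hom (pt_dom P) (pt_dom Q);
  pt_hom_map : pt_map Q ∘ pt_hom = pt_map P;
  pt_hom_sec : pt_hom ∘ pt_sec P = pt_sec Q
}.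

Lemma PointHom_eq (P Q : Point) (u v : PointHom P Q) :
  pt_hom u = pt_hom v -> u = v.
Proof.
destruct u as [u u1 u2], v as [v v1 v2]; simpl; intros e; subst v.
f_equal; apply proof_irrelevance.
Qed.

Definition Point_id (P : Point) : PointHom P P :=
  {| pt_hom := idm (pt_dom P);
     pt_hom_map := comp_idr (pt_map P);
     pt_hom_sec := comp_idl (pt_sec P) |}.

Definition Point_comp (P Q R : Point) (v : PointHom Q R) (u : PointHom P Q) :
  PointHom P R.
Proof.
refine {| pt_hom := pt_hom v ∘ pt_hom u |}.
- abstract (rewrite comp_assoc, !pt_hom_map; reflexivity).
- abstract (rewrite <- comp_assoc, !pt_hom_sec; reflexivity).
Defined.

Definition Pt : Category.
Proof.
refine {| Obj := Point; Hom := PointHom; idm := Point_id; comp := Point_comp |}.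
- abstract (intros P Q f; apply PointHom_eq, comp_idl).
- abstract (intros P Q f; apply PointHom_eq, comp_idr).
- abstract (intros P Q R S h g f; apply PointHom_eq, comp_assoc).
Defined.

End Points.

Lemma pairing_eq (C : OrdCategory) (X Y Z : C) (f : Hom X Y) (g : Hom Z Y)
    (c : CommaObject f g) (A : C) (l l' : Hom A (capex c)) :
  cpi1 c ∘ l = cpi1 c ∘ l' -> cpi2 c ∘ l = cpi2 c ∘ l' -> l = l'.
Proof.
intros e1 e2.
assert (H : f ∘ (cpi1 c ∘ l') ≼ g ∘ (cpi2 c ∘ l')).
{ rewrite !comp_assoc; apply hle_precomp, comma_le. }
rewrite (pairing_unique H e1 e2); symmetry; now apply pairing_unique.
Qed.

Section HorizontalComma.

Variables (C : OrdCategory) (commas : comma_objects C).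
Variables (A Y : C) (alpha : Hom A Y).

Lemma Hcomma_sec_le (P : Point Y) :
  pt_map P ∘ (pt_sec P ∘ alpha) ≼ alpha ∘ idm A.
Proof.
rewrite comp_assoc, pt_split, comp_idl, comp_idr.
apply (hle_preorder A Y).
Qed.

Definition Hcomma_obj (P : Point Y) : Point A :=
  {| pt_dom := capex (commas (pt_map P) alpha);
     pt_map := cpi2 (commas (pt_map P) alpha);
     pt_sec := pairing (commas (pt_map P) alpha) (Hcomma_sec_le P);
     pt_split := pairing_pi2 (commas (pt_map P) alpha) (Hcomma_sec_le P) |}.

Lemma Hcomma_hom_le (P Q : Point Y) (u : PointHom P Q) :
  pt_map Q ∘ (pt_hom u ∘ cpi1 (commas (pt_map P) alpha))
  ≼ alpha ∘ cpi2 (commas (pt_map P) alpha).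
Proof. rewrite comp_assoc, pt_hom_map; apply comma_le. Qed.

Definition Hcomma_hom (P Q : Point Y) (u : PointHom P Q) :
  PointHom (Hcomma_obj P) (Hcomma_obj Q).
Proof.
refine (@Build_PointHom C A (Hcomma_obj P) (Hcomma_obj Q)
          (pairing (commas (pt_map Q) alpha) (Hcomma_hom_le u)) _ _).
- abstract (simpl; apply pairing_pi2).
- abstract (simpl; apply pairing_eq; rewrite comp_assoc;
    [ rewrite !pairing_pi1, <- comp_assoc, pairing_pi1, comp_assoc, pt_hom_sec
    | rewrite !pairing_pi2 ]; reflexivity).
Defined.

Definition Hcomma : Functor (Pt Y) (Pt A).
Proof.
refine (@Build_Functor (Pt Y) (Pt A) Hcomma_obj Hcomma_hom _ _).
- abstract (intros P; apply PointHom_eq; simpl; symmetry;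
    apply pairing_unique; simpl; rewrite ?comp_idl, ?comp_idr; reflexivity).
- abstract (intros P Q R v u; apply PointHom_eq; simpl; symmetry;
    apply pairing_unique; simpl; rewrite comp_assoc;
    [ rewrite pairing_pi1, <- comp_assoc, pairing_pi1, comp_assoc
    | rewrite !pairing_pi2 ]; reflexivity).
Defined.

End HorizontalComma.

(* Main.v *)
From Stdlib Require Import List.
Require Import Defs.

Set Implicit Arguments.
Unset Strict Implicit.
Unset Printing Implicit Defensive.

(** Joint extremal epimorphy of [(pi1, s)] amounts to [H_alpha] reflecting
    isomorphisms among the monomorphisms of points with codomain [(f, s)]; what
    remains is that it then reflects monomorphisms too.

    From conservativity to joint extremal epimorphy: a monomorphism [m] through
    which [s] and the projection [pi1 : f/alpha -> X] factor is a monomorphism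
    of points, because [s] factors through it.  The factorization of [pi1]
    inverts [H_alpha m], so [m] is an isomorphism.

    Conversely, let [gamma : (g, t) -> (f, s)] be a morphism of points with
    [H_alpha gamma] invertible.  Both [s = gamma t] and [pi1] (by composing with
    the inverse of [H_alpha gamma]) factor through [gamma], so it is enough that
    [gamma] be a monomorphism.  This comes from a second use of joint extremal
    epimorphy, for the kernel pair [(p1, p2)] of [gamma], which is a point over
    [Y] whose section factors through the diagonal [d].  As [H_alpha gamma] is
    monic, [p1] and [p2] agree on [(g p1)/alpha], so that its projection to the
    kernel pair also factors through [d].  Hence the split monomorphism [d] is
    an isomorphism and [p1 = p2]. *)

(** * Pullbacks *)

Inductive cospan_obj := cleft | cright | csink.

Definition cospan_hom (i j : cospan_obj) : Set :=
  match i, j with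
  | cleft, cright | cright, cleft | csink, cleft | csink, cright => Empty_set
  | _, _ => unit
  end.

Definition cospan_id (i : cospan_obj) : cospan_hom i i :=
  match i with cleft | cright | csink => tt end.

Definition cospan_comp (i j k : cospan_obj) :
  cospan_hom j k -> cospan_hom i j -> cospan_hom i k.
Proof.
  destruct i, j, k; simpl; intros v u; solve [exact tt | destruct u | destruct v].
Defined.

Lemma cospan_hom_irrelevant (i j : cospan_obj) (u v : cospan_hom i j) : u = v.
Proof. destruct i, j, u, v; reflexivity. Qed.

Definition cospan : Category.
Proof.
  refine {| Obj := cospan_obj; Hom := cospan_hom; idm := cospan_id;
            comp := cospan_comp |};
    intros; apply cospan_hom_irrelevant.
Defined.

Lemma cospan_finite : finite_category cospan.
Proof.
  split.
  - exists (cleft :: cright :: csink :: nil); intros []; simpl; tauto.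
  - intros [] []; simpl;
      solve [exists (tt :: nil); intros []; simpl; tauto | exists nil; intros []].
Qed.

Section CospanDiagram.

Variables (C : Category) (X Y Z : C) (f : Hom X Z) (g : Hom Y Z).

Definition cospan_fobj (i : cospan_obj) : C :=
  match i with cleft => X | cright => Y | csink => Z end.

Definition cospan_fmap (i j : cospan_obj) :
  cospan_hom i j -> Hom (cospan_fobj i) (cospan_fobj j) :=
  match i, j with
  | cleft, cleft => fun _ => idm X
  | cright, cright => fun _ => idm Y
  | csink, csink => fun _ => idm Z
  | cleft, csink => fun _ => f
  | cright, csink => fun _ => g
  | _, _ => fun e : Empty_set => match e with end
  end.

Definition cospan_diagram : Functor cospan C.
Proof.
  refine (@Build_Functor cospan C cospan_fobj cospan_fmap _ _).
  - intros []; reflexivity.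
  - intros [] [] [] [] []; simpl; rewrite ?comp_idl, ?comp_idr; reflexivity.
Defined.

Definition cospan_cone (W : C) (u : Hom W X) (v : Hom W Y)
    (e : f ∘ u = g ∘ v) : Cone cospan_diagram.
Proof.
  refine (@Build_Cone cospan C cospan_diagram W
    (fun j => match j return Hom W (cospan_fobj j) with
              | cleft => u | cright => v | csink => f ∘ u end) _).
  intros [] [] []; simpl; rewrite ?comp_idl; congruence.
Defined.

End CospanDiagram.

Lemma pullback_exists (C : Category) (HC : finitely_complete C)
    (X Y Z : C) (f : Hom X Z) (g : Hom Y Z) :
  exists (P : C) (p : Hom P X) (q : Hom P Y), f ∘ p = g ∘ q /\
    forall (W : C) (u : Hom W X) (v : Hom W Y), f ∘ u = g ∘ v ->
      exists! h : Hom W P, p ∘ h = u /\ q ∘ h = v.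
Proof.
  destruct (HC cospan cospan_finite (cospan_diagram f g)) as [L limL].
  pose proof (leg_natural L (i := cleft) (j := csink) tt) as el.
  pose proof (leg_natural L (i := cright) (j := csink) tt) as er.
  simpl in el, er.
  exists (vertex L), (leg L cleft), (leg L cright); split; [congruence|].
  intros W u v e.
  destruct (limL (cospan_cone e)) as [h [hL huniq]].
  exists h; split.
  - exact (conj (hL cleft) (hL cright)).
  - intros k [ku kv]; apply huniq; intros []; simpl; try assumption.
    rewrite <- el, <- comp_assoc, ku; reflexivity.
Qed.

(** * Isomorphisms and monomorphisms *)

Lemma iso_mono (C : Category) (X Y : C) (f : Hom X Y) : is_iso f -> is_mono f.
Proof.
  intros [g [gf _]] W u v e.
  rewrite <- (comp_idl u), <- (comp_idl v), <- gf, <- !comp_assoc, e.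
  reflexivity.
Qed.

Lemma split_mono (C : Category) (X Y : C) (f : Hom X Y) (g : Hom Y X) :
  g ∘ f = idm X -> is_mono f.
Proof.
  intros gf W u v e.
  rewrite <- (comp_idl u), <- (comp_idl v), <- gf, <- !comp_assoc, e.
  reflexivity.
Qed.

Lemma mono_split_epi_iso (C : Category) (X Y : C) (f : Hom X Y) (g : Hom Y X) :
  is_mono f -> f ∘ g = idm Y -> is_iso f.
Proof.
  intros mono fg; exists g; split; [|exact fg].
  apply mono; rewrite comp_assoc, fg, comp_idl, comp_idr; reflexivity.
Qed.

Lemma point_iso_iff (C : Category) (Y : C) (P Q : Point Y) (u : PointHom P Q) :
  is_iso (C := Pt Y) u <-> is_iso (pt_hom u).
Proof.
  split.
  - intros [v [vu uv]]; exists (pt_hom v); split.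
    + exact (f_equal (@pt_hom _ _ _ _) vu).
    + exact (f_equal (@pt_hom _ _ _ _) uv).
  - intros [v [vu uv]].
    assert (vm : pt_map P ∘ v = pt_map Q).
    { rewrite <- (pt_hom_map u), <- comp_assoc, uv; apply comp_idr. }
    assert (vs : v ∘ pt_sec Q = pt_sec P).
    { rewrite <- (pt_hom_sec u), comp_assoc, vu; apply comp_idl. }
    exists (Build_PointHom vm vs); split; apply PointHom_eq; assumption.
Qed.

(** Only the diagonal of the kernel pair matters: once it is invertible, its
    inverse equals both projections. *)
Lemma mono_of_diagonal_iso (C : Category) (X Y K : C) (f : Hom X Y)
    (p q : Hom K X) (d : Hom X K) :
  (forall (W : C) (u v : Hom W X), f ∘ u = f ∘ v ->
    exists h : Hom W K, p ∘ h = u /\ q ∘ h = v) ->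
  p ∘ d = idm X -> q ∘ d = idm X -> is_iso d -> is_mono f.
Proof.
  intros univ pd qd [e [_ de]] W u v fuv.
  assert (pq : p = q).
  { rewrite <- (comp_idr p), <- (comp_idr q), <- de, !comp_assoc, pd, qd.
    reflexivity. }
  destruct (univ W u v fuv) as [h [hu hv]]; congruence.
Qed.

(** * The horizontal comma functor *)

Section Horizontal.

Variables (C : OrdCategory) (commas : comma_objects C).
Variables (A Y : C) (alpha : Hom A Y).

Lemma Hcomma_mono (P Q : Point Y) (u : PointHom P Q) :
  is_mono (pt_hom u) -> is_mono (pt_hom (fmap (Hcomma commas alpha) u)).
Proof.
  intros mono W k l e; simpl in *.
  apply pairing_eq.
  - apply mono; rewrite !comp_assoc.
    rewrite <- (pairing_pi1 (commas (pt_map Q) alpha)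
      (Hcomma_hom_le commas alpha u)).
    rewrite <- !comp_assoc, e; reflexivity.
  - rewrite <- (pairing_pi2 (commas (pt_map Q) alpha)
      (Hcomma_hom_le commas alpha u)), <- !comp_assoc, e.
    reflexivity.
Qed.

(** A factorization [a] of the comma projection through [u] gives the section
    [<a, pi2>] of [H_alpha u], which inverts it as soon as [u] is monic. *)
Lemma Hcomma_iso_of_factor (P Q : Point Y) (u : PointHom P Q)
    (a : Hom (capex (commas (pt_map Q) alpha)) (pt_dom P)) :
  is_mono (pt_hom u) ->
  pt_hom u ∘ a = cpi1 (commas (pt_map Q) alpha) ->
  is_iso (fmap (Hcomma commas alpha) u).
Proof.
  intros mono ua; apply point_iso_iff.
  assert (le : pt_map P ∘ a ≼ alpha ∘ cpi2 (commas (pt_map Q) alpha)).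
  { rewrite <- (pt_hom_map u), <- comp_assoc, ua; apply comma_le. }
  apply (@mono_split_epi_iso C _ _ _ (pairing (commas (pt_map P) alpha) le)).
  - apply Hcomma_mono; exact mono.
  - simpl; apply pairing_eq; rewrite comp_assoc, comp_idr.
    + rewrite pairing_pi1, <- comp_assoc, pairing_pi1; exact ua.
    + rewrite !pairing_pi2; reflexivity.
Qed.

Lemma factor_of_Hcomma_iso (P Q : Point Y) (u : PointHom P Q) :
  is_iso (fmap (Hcomma commas alpha) u) ->
  exists a : Hom (capex (commas (pt_map Q) alpha)) (pt_dom P),
    pt_hom u ∘ a = cpi1 (commas (pt_map Q) alpha).
Proof.
  intros iso; apply point_iso_iff in iso; destruct iso as [v [_ uv]].
  exists (cpi1 _ ∘ v); simpl in *.
  rewrite comp_assoc, <- (pairing_pi1 (commas (pt_map Q) alpha)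
      (Hcomma_hom_le commas alpha u)).
  rewrite <- comp_assoc, uv, comp_idr; reflexivity.
Qed.

(** Monicity of [H_alpha u] is cancellation of [u] against those morphisms
    that admit a second component completing them to a map into the comma
    object. *)
Lemma Hcomma_mono_cancel (P Q : Point Y) (u : PointHom P Q) (W : C)
    (k l : Hom W (pt_dom P)) (b : Hom W A) :
  is_mono (pt_hom (fmap (Hcomma commas alpha) u)) ->
  pt_map P ∘ k ≼ alpha ∘ b -> pt_hom u ∘ k = pt_hom u ∘ l -> k = l.
Proof.
  intros mono lek ukl.
  assert (lel : pt_map P ∘ l ≼ alpha ∘ b).
  { rewrite <- (pt_hom_map u), <- comp_assoc, <- ukl, comp_assoc, pt_hom_map.
    exact lek. }
  assert (e : pairing (commas (pt_map P) alpha) lek = pairing _ lel).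
  { apply mono; simpl; apply pairing_eq; rewrite !comp_assoc.
    - rewrite !pairing_pi1, <- !comp_assoc, !pairing_pi1; exact ukl.
    - rewrite !pairing_pi2; reflexivity. }
  rewrite <- (pairing_pi1 (commas (pt_map P) alpha) lek), e; apply pairing_pi1.
Qed.

(** Applied to the kernel pair of [u], regarded as a point over [Y] with
    section the diagonal after that of [P], the hypothesis forces the diagonal
    to be invertible. *)
Lemma mono_of_Hcomma_mono (HC : finitely_complete C) :
  (forall (X : C) (f : Hom X Y) (s : Hom Y X), f ∘ s = idm Y ->
    jointly_extremally_epic (cpi1 (commas f alpha)) s) ->
  forall (P Q : Point Y) (u : PointHom P Q),
  is_mono (pt_hom (fmap (Hcomma commas alpha) u)) -> is_mono (pt_hom u).
Proof.
  intros jee P Q u mono.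
  destruct (pullback_exists HC (pt_hom u) (pt_hom u))
    as [K [p [q [upq univ]]]].
  destruct (univ _ (idm _) (idm _) eq_refl) as [d [[pd qd] _]].
  apply (@mono_of_diagonal_iso C _ _ K (pt_hom u) p q d); trivial.
  { intros W k l e; destruct (univ W k l e) as [h [hkl _]]; exists h; exact hkl. }
  set (c := commas (pt_map P ∘ p) alpha).
  assert (pq : p ∘ cpi1 c = q ∘ cpi1 c).
  { apply (Hcomma_mono_cancel (b := cpi2 c) mono).
    - rewrite comp_assoc; apply comma_le.
    - rewrite !comp_assoc, upq; reflexivity. }
  assert (split : (pt_map P ∘ p) ∘ (d ∘ pt_sec P) = idm Y).
  { rewrite comp_assoc, <- (comp_assoc _ p d), pd, comp_idr; apply pt_split. }
  apply (jee K _ _ split).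
  - exact (split_mono pd).
  - exists (p ∘ cpi1 c).
    (* [cpi1 c] and its image under [d p] have the same two components in the
       kernel pair, the second by [pq]. *)
    destruct (univ _ (p ∘ cpi1 c) (q ∘ cpi1 c)) as [h [_ huniq]].
    { rewrite !comp_assoc, upq; reflexivity. }
    transitivity h; [symmetry|]; apply huniq; [|split; reflexivity].
    rewrite !comp_assoc, pd, qd, !comp_idl.
    split; [reflexivity | exact pq].
  - exists (pt_sec P); reflexivity.
Qed.

End Horizontal.

(** * The equivalence *)

Theorem corollary2p12 (C : OrdCategory) (HC : finitely_complete C)
    (commas : comma_objects C) :
  (forall (A Y : C) (alpha : Hom A Y), conservative (Hcomma commas alpha))
  <->
  (forall (A Y : C) (alpha : Hom A Y)
      (X : C) (f : Hom X Y) (s : Hom Y X), f ∘ s = idm Y ->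
    jointly_extremally_epic (cpi1 (commas X Y A f alpha)) s).
Proof.
  split.
  - intros cons A Y alpha X f s fs M m mono [a ma] [b mb].
    assert (fmb : (f ∘ m) ∘ b = idm Y) by (rewrite <- comp_assoc, mb; exact fs).
    pose (u := @Build_PointHom C Y (Build_Point fmb) (Build_Point fs) m eq_refl mb).
    apply (point_iso_iff u), (cons A Y alpha).
    exact (Hcomma_iso_of_factor (u := u) mono ma).
  - intros jee A Y alpha P Q u iso.
    apply point_iso_iff.
    apply (jee A Y alpha _ _ _ (pt_split Q)).
    + apply (mono_of_Hcomma_mono HC (jee A Y alpha)).
      apply iso_mono, point_iso_iff, iso.
    + exact (factor_of_Hcomma_iso iso).
    + exists (pt_sec P); apply pt_hom_sec.
Qed.
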